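(* Let $I=[-1,1]$ and let $\{\phi_k\}_{k\ge 0}$ be the compact combination basis of Chebyshev polynomials associated with the homogeneous boundary conditions $$a_-u(-1)+b_-u'(-1)=0,\qquad a_+u(1)+b_+u'(1)=0 .\qquad (\mathrm{BC})$$ Let $s\ge 0$ and let $\mathcal G_\theta$ be any orthogonal polynomial neural operator (OPNO) on $H^s(I)$ with underlying basis $\{\phi_k\}$ whose final layer is a projection operator of the form $$\mathcal Q(v)=\mathcal S^{-1}\big[\mathbf 1_{k\le N}\,\mathcal S(Q(v))\big],$$ where $Q$ is a (shallow) neural network. Then for every $a\in H^s(I)$ the output $u=\mathcal G_\theta(a)$ satisfies the boundary conditions $(\mathrm{BC})$ of the underlying basis (componentwise, if the output is vector valued).
   Context: Chebyshev polynomials: $T_0=1$, $T_1(x)=x$, $T_{n+1}(x)=2xT_n(x)-T_{n-1}(x)$ for $n\ge1$. Compact combination basis: fix real constants $a_\pm,b_\pm$ (Dirichlet: $a_\pm=1,b_\pm=0$; Neumann: $a_\pm=0,b_\pm=1$; in general Robin) such that for every $k\ge 0$ there is a unique pair $(a_k,b_k)$ of real numbers for which $$\phi_k(x)=T_k(x)+a_kT_{k+1}(x)+b_kT_{k+2}(x)$$ satisfies $a_-\phi_k(-1)+b_-\phi_k'(-1)=0$ and $a_+\phi_k(1)+b_+\phi_k'(1)=0$. For example $\phi_k=T_k-T_{k+2}$ for Dirichlet and $\phi_k=T_k-\frac{k^2}{(k+2)^2}T_{k+2}$ for Neumann conditions. Chebyshev transform $\mathcal C_h$ (with resolution $N$):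 for $u\in C(I)$, $\mathcal C_h u=(\hat u_n)_{0\le n\le N}$ is the vector of Chebyshev coefficients of the polynomial $I_Nu=\sum_{n=0}^N\hat u_nT_n$ of degree at most $N$ interpolating $u$ at the Chebyshev–Gauss–Lobatto points $x_j=-\cos(\pi j/N)$, $0\le j\le N$. Compacting transform $\mathcal C_p$: it maps Chebyshev coefficients $(\alpha_k)$ to coefficients $(\beta_k)$ with respect to $\{\phi_k\}$, by the recursion $\beta_k=\alpha_k-a_{k-1}\beta_{k-1}-b_{k-2}\beta_{k-2}$ (terms with negative index are $0$); this is the inverse of the map taking $(\beta_k)$ to the Chebyshev coefficients of $\sum_k\beta_k\phi_k$. Shen transform: $\mathcal S=\mathcal C_p\circ\mathcal C_h$. For a finite coefficient vector $(\beta_k)$, $\mathcal S^{-1}(\beta)=\sum_k\beta_k\phi_k$. All transforms act componentwise on vector-valued functions. $\mathbf 1_{k\le N}$ denotes truncation of coefficients to indices $k\le N$. OPNO: a map $\mathcal G_\theta=\mathcal Q\circ\mathcal L^{(L)}\circ\cdots\circ\mathcal L^{(1)}\circ\mathcal P$, where $\mathcal P$ is a lifting layer (a simple neural network sending the input function to an $\mathbb R^{d_v}$-valued function), the layers are $$\mathcal L^{(l)}(v)=v+\sigma\big(W_lv+b_l+\mathcal S^{-1}(A_l\cdot\mathcal C_h(v))\big),$$ with $\sigma$ a non-polynomial activation function applied pointwise, $W_l\in\mathbb R^{d_v\times d_v}$, $b_l$ a bias, $A_l$ a (learnable) linear map on the frequency domain which is a banded block matrix with $d_v\times d_v$ blocks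 truncated to finitely many modes, and $\mathcal Q$ is the final layer. The statement concerns OPNOs whose composition is well defined on $H^s(I)$ (in particular the functions to which $\mathcal C_h$ is applied are such that $\mathcal C_h$ makes sense). *)

(* Defs.v *)
From HB Require Import structures.
From mathcomp Require Import all_boot all_order all_algebra.
From mathcomp Require Import all_classical all_reals all_analysis.
Set Implicit Arguments.
Unset Strict Implicit.
Unset Printing Implicit Defensive.
Import Order.TTheory GRing.Theory Num.Theory.
Import numFieldNormedType.Exports.
Local Open Scope classical_set_scope.
Local Open Scope ring_scope.

(* A function on I = [-1, 1] is represented by a function on R; only its values
   on I are meaningful. *)
Definition I1 (R : realType) : set R := `[-1, 1]%classic.
Arguments I1 : clear implicits.

Definition fct (R : realType) (d : nat) := R -> 'cV[R]_d.

Definition component (R : realType) d (v : fct R d) (i : 'I_d) : R -> R :=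
  fun x => v x i 0.

Definition continuous_on_I (R : realType) d (v : fct R d) : Prop :=
  forall i, {within I1 R, continuous (component v i)}.

Section Sobolev.
Variable R : realType.
Let mu := @lebesgue_measure R.

Definition in_L2 (u : R -> R) : Prop :=
  measurable_fun (I1 R) u /\ (\int[mu]_(x in I1 R) (u x ^+ 2)%:E < +oo)%E.

Definition test_function (psi : R -> R) : Prop :=
  (forall n x, derivable (derive1n n psi) x 1) /\
  (exists2 r, r < 1 & forall x, r < `|x| -> psi x = 0).

Definition weak_derivative (n : nat) (u w : R -> R) : Prop :=
  forall psi, test_function psi ->
    \int[mu]_(x in I1 R) (u x * derive1n n psi x) =
    (-1) ^+ n * \int[mu]_(x in I1 R) (w x * psi x).

(* squared Sobolev-Slobodeckij (Gagliardo) seminorm of order theta in ]0, 1[;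
   the integrand is 0 on the (negligible) diagonal *)
Definition slobodeckij (theta : R) (w : R -> R) : \bar R :=
  (\int[mu \x mu]_(z in I1 R `*` I1 R)
    (`|w z.1 - w z.2| ^+ 2 / (`|z.1 - z.2| `^ (1 + 2 * theta)))%:E)%E.

(* s = m + theta with m its integer part *)
Definition sobolev (s : R) (u : R -> R) : Prop :=
  exists (m : nat) (theta : R) (D : nat -> R -> R),
    [/\ s = m%:R + theta, 0 <= theta < 1, D 0%N = u,
        forall n, (n <= m)%N -> in_L2 (D n) /\ weak_derivative n u (D n) &
        0 < theta -> (slobodeckij theta (D m) < +oo)%E].

Definition vsobolev (s : R) d (v : fct R d) : Prop :=
  forall i, sobolev s (component v i).

End Sobolev.

Section Basis.
Variable R : realType.

Fixpoint cheb (n : nat) : {poly R} :=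
  match n with
  | 0 => 1
  | 1 => 'X
  | (m.+1 as k).+1 => 2%:P * 'X * cheb k - cheb m
  end.

(* derivatives at the end points are taken from inside I *)
Definition satisfies_bc (am bm ap bp : R) (u : R -> R) : Prop :=
  exists dl dr : R,
    [/\ (fun h => h^-1 * (u (-1 + h) - u (-1))) @ 0^'+ --> dl,
        (fun h => h^-1 * (u (1 + h) - u 1)) @ 0^'- --> dr,
        am * u (-1) + bm * dl = 0 &
        ap * u 1 + bp * dr = 0].

Definition combination (k : nat) (ab : R * R) : {poly R} :=
  cheb k + ab.1 *: cheb k.+1 + ab.2 *: cheb k.+2.

Definition compact_combination (am bm ap bp : R) (a b : nat -> R) : Prop :=
  forall k, unique
    (fun ab => satisfies_bc am bm ap bp (fun x => (combination k ab).[x]))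
    (a k, b k).

End Basis.

Section Transforms.
Variables (R : realType) (a b : nat -> R) (N : nat).

Definition phi (k : nat) : {poly R} := combination k (a k, b k).

Definition cgl_node (j : nat) : R := - cos (pi * j%:R / N%:R).

Definition cheb_interpolant (u : R -> R) (c : seq R) : Prop :=
  size c = N.+1 /\
  forall j, (j <= N)%N ->
    (\sum_(n < N.+1) c`_n *: cheb R n).[cgl_node j] = u (cgl_node j).

(* for 0 < N the nodes are distinct, so exactly one list c qualifies *)
Definition cheb_coef (u : R -> R) : seq R := xget [::] (cheb_interpolant u).

Definition Ch d (v : fct R d) : seq 'cV[R]_d :=
  mkseq (fun n => \col_i (cheb_coef (component v i))`_n) N.+1.

(* alpha is extended by 0 beyond its length; the result is in general an
   infinite sequence, even though alpha is finite *)
Fixpoint Cp d (alpha : seq 'cV[R]_d) (k : nat) : 'cV[R]_d :=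
  match k with
  | 0 => alpha`_0
  | k1.+1 => alpha`_k1.+1 - a k1 *: Cp alpha k1 -
             (if k1 is k2.+1 then b k2 *: Cp alpha k2 else 0)
  end.

Definition shen d (v : fct R d) : nat -> 'cV[R]_d := Cp (Ch v).

Definition shen_inv d (beta : seq 'cV[R]_d) : fct R d :=
  fun x => \sum_(k < size beta) (phi k).[x] *: beta`_k.

(* 1_{k <= N}, giving a finite coefficient vector *)
Definition trunc d (beta : nat -> 'cV[R]_d) : seq 'cV[R]_d := mkseq beta N.+1.

End Transforms.

(* An affine map between spaces of functions on I,
     v |-> W v(x) + c(x) + \int_I K(x, y) v(y) dy.
   With K = 0 this is a layer applied pointwise (to v(x), or to (x, v(x)),
   since the bias may depend on x); the kernel term also allows nonlocal lifting
   layers, needed when the input has no pointwise values (s <= 1/2). *)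
Record affine (R : realType) (m n : nat) := Affine {
  weight : 'M[R]_(n, m);
  bias : R -> 'cV[R]_n;
  kernel : R -> R -> 'M[R]_(n, m)
}.

Definition affine_eval (R : realType) m n (A : affine R m n) (v : fct R m) :
    fct R n :=
  fun x => weight A *m v x + bias A x +
    \col_i \int[@lebesgue_measure R]_(y in I1 R) (kernel A x y *m v y) i 0.

(* any depth: the shallow networks are the Hidden A rho (Output B) *)
Inductive network (R : realType) : nat -> nat -> Type :=
| Output m n of affine R m n : network R m n
| Hidden m k n of affine R m k & (R -> R) & network R k n : network R m n.

Fixpoint network_eval (R : realType) m n (net : network R m n) :
    fct R m -> fct R n :=
  match net with
  | Output _ _ A => affine_eval A
  | Hidden _ _ _ A rho net' =>
      fun v => network_eval net' (fun x => map_mx rho (affine_eval A v x))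
  end.

(* a linear map on coefficient vectors, given by its d x d blocks *)
Record freq_map (R : realType) (d : nat) := FreqMap {
  block : nat -> nat -> 'M[R]_d;
  bandwidth : nat;
  modes : nat;
  block_banded : forall k n,
    (k + bandwidth < n)%N || (n + bandwidth < k)%N -> block k n = 0;
  block_truncated : forall k n,
    (modes <= k)%N || (modes <= n)%N -> block k n = 0
}.

Definition freq_map_apply (R : realType) d (A : freq_map R d)
    (alpha : seq 'cV[R]_d) : seq 'cV[R]_d :=
  mkseq (fun k => \sum_(n < size alpha) block A k n *m alpha`_n) (modes A).

Record opno_layer (R : realType) (d : nat) := OpnoLayer {
  layer_weight : 'M[R]_d;
  layer_bias : R -> 'cV[R]_d;
  layer_freq : freq_map R d
}.

(* dI, dv, dO: dimensions of the input, of the hidden states, of the output *)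
Record opno (R : realType) (dI dv dO : nat) := Opno {
  activation : R -> R;
  activation_nonpoly : ~ exists p : {poly R}, forall x, activation x = p.[x];
  lifting : network R dI dv;
  layers : seq (opno_layer R dv);
  readout : network R dv dO
}.

Section OpnoEval.
Variables (R : realType) (a b : nat -> R) (N : nat).

Definition layer_eval d (sigma : R -> R) (l : opno_layer R d) (v : fct R d) :
    fct R d :=
  fun x => v x + map_mx sigma
    (layer_weight l *m v x + layer_bias l x +
     shen_inv a b (freq_map_apply (layer_freq l) (Ch N v)) x).

(* the head of the list is the first layer applied *)
Definition layers_eval d sigma (ls : seq (opno_layer R d)) (v : fct R d) :=
  foldl (fun w l => layer_eval sigma l w) v ls.

Fixpoint layers_defined d sigma (ls : seq (opno_layer R d)) (v : fct R d) :
    Prop :=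
  if ls is l :: ls' then
    continuous_on_I v /\ layers_defined sigma ls' (layer_eval sigma l v)
  else True.

Section Eval.
Variables (dI dv dO : nat) (G : opno R dI dv dO).

Definition opno_hidden (f : fct R dI) : fct R dv :=
  layers_eval (activation G) (layers G) (network_eval (lifting G) f).

(* the final layer Q(v) = S^-1 [1_{k <= N} S (Q v)] *)
Definition projection_layer (v : fct R dv) : fct R dO :=
  shen_inv a b (trunc N (shen a b N (network_eval (readout G) v))).

Definition opno_eval (f : fct R dI) : fct R dO :=
  projection_layer (opno_hidden f).

(* every function to which Ch is applied along the evaluation is in C(I) *)
Definition opno_defined (f : fct R dI) : Prop :=
  layers_defined (activation G) (layers G) (network_eval (lifting G) f) /\
  continuous_on_I (network_eval (readout G) (opno_hidden f)).

(* f stands for its class modulo equality almost everywhere on I: u is the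
   output on I when G is evaluated at some representative f' of f for which
   all transforms make sense (e.g. the continuous one, if s > 1/2) *)
Definition opno_output (f : fct R dI) (u : fct R dO) : Prop :=
  exists f' : fct R dI,
    [/\ ae_eq (@lebesgue_measure R) (I1 R) f f',
        opno_defined f' &
        forall x, I1 R x -> u x = opno_eval f' x].

Definition opno_well_defined (s : R) : Prop :=
  forall f : fct R dI, vsobolev s f ->
    exists2 u, opno_output f u &
      forall u', opno_output f u' -> forall x, I1 R x -> u' x = u x.

End Eval.
End OpnoEval.

(* Main.v *)
Require Import Defs.
From mathcomp Require Import all_boot all_order all_algebra.
From mathcomp Require Import all_classical all_reals all_analysis.
From mathcomp Require Import lra.
Import Order.TTheory GRing.Theory Num.Theory.
Local Open Scope ring_scope.

(** The last step of the final layer is [shen_inv], so on I each component of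
    the output is a finite linear combination of the basis polynomials [phi k];
    the input and the preceding layers only determine its coefficients. Each
    [phi k] satisfies the boundary conditions by the choice of (a_k, b_k), and
    the conditions are linear and homogeneous, so the functions that satisfy
    them form a vector space ([satisfies_bc_sum], [satisfies_bcZ]). The output is
    a function on R that is only prescribed on I; this suffices because the
    conditions involve one-sided derivatives from inside I, hence only the values
    on I ([eq_on_I_satisfies_bc]). *)

Section BoundaryConditions.
Variables (R : realType) (am bm ap bp : R).
Import numFieldNormedType.Exports.
Local Open Scope classical_set_scope.

Implicit Types u v : R -> R.

Lemma satisfies_bc0 : satisfies_bc am bm ap bp (fun=> 0).
Proof.
exists 0, 0; split; rewrite ?mulr0 ?addr0 //.
- under eq_fun do rewrite subrr mulr0; exact: cvg_cst.
- under eq_fun do rewrite subrr mulr0; exact: cvg_cst.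
Qed.

Lemma satisfies_bcD u v :
  satisfies_bc am bm ap bp u -> satisfies_bc am bm ap bp v ->
  satisfies_bc am bm ap bp (fun x => u x + v x).
Proof.
move=> [ul [ur [ulP urP um up]]] [vl [vr [vlP vrP vm vp]]].
have diffD (c h : R) : h^-1 * (u (c + h) + v (c + h) - (u c + v c)) =
    h^-1 * (u (c + h) - u c) + h^-1 * (v (c + h) - v c).
  by rewrite -mulrDr opprD addrACA.
exists (ul + vl), (ur + vr); split.
- by under eq_fun do rewrite diffD; exact: cvgD.
- by under eq_fun do rewrite diffD; exact: cvgD.
- by rewrite !mulrDr addrACA um vm addr0.
- by rewrite !mulrDr addrACA up vp addr0.
Qed.

Lemma satisfies_bcZ (c : R) u :
  satisfies_bc am bm ap bp u -> satisfies_bc am bm ap bp (fun x => u x * c).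
Proof.
move=> [ul [ur [ulP urP um up]]].
have diffZ (e h : R) :
    h^-1 * (u (e + h) * c - u e * c) = h^-1 * (u (e + h) - u e) * c.
  by rewrite -mulrBl mulrA.
exists (ul * c), (ur * c); split.
- by under eq_fun do rewrite diffZ; apply: cvgM => //; exact: cvg_cst.
- by under eq_fun do rewrite diffZ; apply: cvgM => //; exact: cvg_cst.
- by rewrite !mulrA -mulrDl um mul0r.
- by rewrite !mulrA -mulrDl up mul0r.
Qed.

Lemma satisfies_bc_sum n (F : 'I_n -> R -> R) :
  (forall k, satisfies_bc am bm ap bp (F k)) ->
  satisfies_bc am bm ap bp (fun x => \sum_(k < n) F k x).
Proof.
move=> FP; elim: n => [|n IHn] in F FP *.
  by under eq_fun do rewrite big_ord0; exact: satisfies_bc0.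
under eq_fun do rewrite big_ord_recr /=.
by apply: satisfies_bcD => //; exact: IHn.
Qed.

(** A point within distance 2 of an end point, on its inner side, lies in I, so
    the difference quotients of u and v agree near 0 on that side. *)
Lemma eq_on_I_satisfies_bc u v : (forall x, I1 R x -> v x = u x) ->
  satisfies_bc am bm ap bp u -> satisfies_bc am bm ap bp v.
Proof.
move=> vu [dl [dr [dlP drP um up]]].
have I1P (x : R) : -1 <= x <= 1 -> v x = u x.
  by move=> x1; apply: vu; rewrite /I1/= in_itv.
have vN1 : v (-1) = u (-1) by apply: I1P; lra.
have v1 : v 1 = u 1 by apply: I1P; lra.
exists dl, dr; split; rewrite ?vN1 ?v1 //.
- apply: cvg_trans dlP; apply: near_eq_cvg; near=> h.
  have h_gt0 : 0 < h by near: h; exact: nbhs_right_gt.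
  have h_lt2 : h < 2 by near: h; exact: nbhs_right_lt.
  by rewrite (I1P (-1 + h)) //; lra.
- apply: cvg_trans drP; apply: near_eq_cvg; near=> h.
  have h_lt0 : h < 0 by near: h; exact: nbhs_left_lt.
  have h_gtN2 : - 2 < h by near: h; apply: nbhs_left_gt; lra.
  by rewrite (I1P (1 + h)) //; lra.
Unshelve. all: by end_near. Qed.

End BoundaryConditions.

Lemma component_shen_inv_satisfies_bc (R : realType) (am bm ap bp : R)
    (a b : nat -> R) d (beta : seq 'cV[R]_d) (i : 'I_d) :
  compact_combination am bm ap bp a b ->
  satisfies_bc am bm ap bp (component (shen_inv a b beta) i).
Proof.
move=> hab.
have -> : component (shen_inv a b beta) i =
    fun x => \sum_(k < size beta) (phi a b k).[x] * (beta`_k) i 0.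
  apply/funext => x; rewrite /component /shen_inv summxE.
  by apply: eq_bigr => k _; rewrite mxE.
apply: satisfies_bc_sum => k; apply: satisfies_bcZ.
by have [] := hab k.
Qed.

Theorem theorem3p1 (R : realType) (am bm ap bp : R) (a b : nat -> R)
    (hab : compact_combination am bm ap bp a b)
    (N : nat) (hN : (0 < N)%N) (s : R) (hs : 0 <= s)
    (dI dv dO : nat) (G : opno R dI dv dO)
    (hG : opno_well_defined a b N G s)
    (f : fct R dI) (hf : vsobolev s f)
    (u : fct R dO) (hu : opno_output a b N G f u) :
  forall i : 'I_dO, satisfies_bc am bm ap bp (component u i).
Proof.
move=> i; have [f' [_ _ uE]] := hu.
apply: (@eq_on_I_satisfies_bc _ _ _ _ _ (component (opno_eval a b N G f') i)).
  by move=> x Ix; rewrite /component uE.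
exact: component_shen_inv_satisfies_bc.
Qed.
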